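(* Let $i\ge2$ be an integer and $\alpha\in(0,\pi/2]$. If $i$ is even, then the rescaled curves $\frac{\sqrt2}{w^{[i]}_{6k+5}}\,\mathcal{F}^{[i]}_{6k+5}$ converge as $k\to\infty$ in the Hausdorff metric on nonempty compact subsets of $\mathbb{R}^2$ (i.e. a scaling limit exists). If $i$ is odd, then the rescaled curves $\frac{\sqrt2}{w^{[i]}_{6k+3}}\,\mathcal{F}^{[i]}_{6k+3}$ converge as $k\to\infty$ in the Hausdorff metric.
   Context: For an integer $i\ge2$, the $i$-Fibonacci words over $\{0,1\}$ are defined by $f^{[i]}_1=0$, $f^{[i]}_2=0^{i-1}1$ (where $0^{i-1}$ denotes $i-1$ zeros), and $f^{[i]}_n=f^{[i]}_{n-1}f^{[i]}_{n-2}$ for $n\ge3$. Drawing rule with drawing angle $\alpha$: given a word $a_1\cdots a_N$, start at the origin with current direction $\theta=\pi/2$. For $j=1,\dots,N$, first draw a unit segment from the current point in direction $\theta$ and move the current point to its endpoint. Then update the direction: if $a_j=0$ and $j$ is even, $\theta\mapsto\theta+\alpha$; if $a_j=0$ and $j$ is odd, $\theta\mapsto\theta-\alpha$; if $a_j=1$, $\theta$ is unchanged. The curve $\mathcal{F}^{[i]}_n\subset\mathbb{R}^2$ is the union of the segments drawn for the word $f^{[i]}_n$; it is a compact set whose first vertex is the origin. $w^{[i]}_n$ denotes the Euclidean distance between the first and last vertices of $\mathcal{F}^{[i]}_n$. For $c>0$ and a set $A$, $cA=\{cx:x\in A\}$ denotes the dilation about the origin. *)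

(* Defs.v *)
From HB Require Import structures.
From mathcomp Require Import all_boot all_order all_algebra.
From mathcomp Require Import all_classical all_reals.
From mathcomp Require Import topology normedtype trigo.
Import numFieldNormedType.Exports.
Set Implicit Arguments. Unset Strict Implicit. Unset Printing Implicit Defensive.
Import Order.TTheory GRing.Theory Num.Theory.
Local Open Scope ring_scope.
Local Open Scope classical_set_scope.

(* Words over {0,1}: letter 0 is [false], letter 1 is [true]. *)
(* fib_pair i n = (f^[i]_{n+1}, f^[i]_{n+2}) *)
Fixpoint fib_pair (i : nat) (n : nat) : seq bool * seq bool :=
  match n with
  | 0 => ([:: false], rcons (nseq i.-1 false) true)
  | n'.+1 => let p := fib_pair i n' in (p.2, p.2 ++ p.1)
  end.

(* fib_word i n = f^[i]_n for n >= 1 *)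
Definition fib_word (i n : nat) : seq bool := (fib_pair i n.-1).1.

Section Drawing.
Variable R : realType.

(* verts alpha w j p th : the endpoints of the segments drawn for the word w,
   whose first letter has (1-based) index j, starting at p with direction th. *)
Fixpoint verts (alpha : R) (w : seq bool) (j : nat) (p : R * R) (th : R)
  : seq (R * R) :=
  match w with
  | [::] => [::]
  | a :: w' =>
      let q := (p.1 + cos th, p.2 + sin th) in
      let th' := if a then th else if odd j then th - alpha else th + alpha in
      q :: verts alpha w' j.+1 q th'
  end.

Definition vertices (alpha : R) (w : seq bool) : seq (R * R) :=
  (0, 0) :: verts alpha w 1 (0, 0) (pi / 2).

Definition segment (p q : R * R) : set (R * R) :=
  [set x | exists t : R, 0 <= t <= 1 /\
     x = (p.1 + t * (q.1 - p.1), p.2 + t * (q.2 - p.2))].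

Definition curve (alpha : R) (w : seq bool) : set (R * R) :=
  [set x | exists k : nat, (k < size w)%N /\
     segment (nth (0, 0) (vertices alpha w) k)
             (nth (0, 0) (vertices alpha w) k.+1) x].

Definition fib_curve (i : nat) (alpha : R) (n : nat) : set (R * R) :=
  curve alpha (fib_word i n).

Definition edist (x y : R * R) : R :=
  Num.sqrt ((x.1 - y.1) ^+ 2 + (x.2 - y.2) ^+ 2).

Definition fib_width (i : nat) (alpha : R) (n : nat) : R :=
  edist (0, 0) (last (0, 0) (vertices alpha (fib_word i n))).

Definition dilate (c : R) (A : set (R * R)) : set (R * R) :=
  [set (c * x.1, c * x.2) | x in A].

(* Convergence in the Hausdorff metric (on nonempty compact subsets of R^2)
   of the sequence A to some nonempty compact K: d_H(A k, K) -> 0, written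
   via the defining inclusions in eps-neighbourhoods. *)
Definition hausdorff_converges (A : nat -> set (R * R)) : Prop :=
  exists K : set (R * R), compact K /\ K !=set0 /\
    forall eps : R, 0 < eps -> exists N : nat, forall k : nat, (N <= k)%N ->
      (forall x, A k x -> exists2 y, K y & edist x y <= eps) /\
      (forall y, K y -> exists2 x, A k x & edist x y <= eps).

End Drawing.

(* Main.v *)
(* Over six steps of the Fibonacci recursion the parity of the length and the
   total turn of the words repeat, and the displacement of the words is
   multiplied by a constant L >= 4 up to a bounded error: it is governed by the
   matrix [[4q^2 - 2q + 1, 2q^2], [4q, 2q + 1]], q = 1 + cos alpha, of
   determinant 1, together with one extra eigenvalue 1.  Since f_{n+2} is the
   concatenation f_{n+1} f_n, the Hausdorff distance D_n between the curve of
   f_{n+6} and the L-dilate of the curve of f_n satisfies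
   D_{n+2} <= max(D_{n+1}, D_n + C), uniformly in the initial direction and
   parity.  Hence D_n grows at most linearly, the curves of f_{6k+r} divided by
   L^k form a Cauchy sequence with summable steps, and so do the curves
   normalised by their widths, which are at least of order L^k. *)
Require Import Defs.
From HB Require Import structures.
From mathcomp Require Import all_boot all_order all_algebra.
From mathcomp Require Import all_classical all_reals.
From mathcomp Require Import topology normedtype trigo.
From mathcomp Require Import ring lra.
Import numFieldNormedType.Exports.
Import Order.TTheory GRing.Theory Num.Theory.
Local Open Scope ring_scope.
Local Open Scope classical_set_scope.

Set Implicit Arguments.
Unset Strict Implicit.

(** * Curves of words with arbitrary starting index and direction *)

Section Trace.
Variables (R : realType) (alpha : R).
Implicit Types (w u v : seq bool) (j n : nat) (th : R) (x y : R * R).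

Definition letter_turn (a : bool) j : R :=
  if a then 0 else if odd j then - alpha else alpha.

Fixpoint turn w j : R :=
  if w is a :: w' then letter_turn a j + turn w' j.+1 else 0.

(** The origin is fixed as starting point while index and direction stay free: the second factor of
    a concatenation is then again given by [disp] and [trace], up to a translation. *)
Fixpoint disp w j th : R * R :=
  if w is a :: w' then (cos th, sin th) + disp w' j.+1 (th + letter_turn a j)
  else 0.

Fixpoint trace w j th : set (R * R) :=
  if w is a :: w' then
    [set t *: ((cos th, sin th) : R * R) | t in [set t : R | 0 <= t <= 1]] `|`
    [set (cos th, sin th) + x | x in trace w' j.+1 (th + letter_turn a j)]
  else set0.

Lemma turn_cat u v j : turn (u ++ v) j = turn u j + turn v (j + size u).
Proof.
elim: u j => [|a u IH] j /=; first by rewrite add0r addn0.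
by rewrite IH addrA addSnnS.
Qed.

Lemma disp_cat u v j th :
  disp (u ++ v) j th = disp u j th + disp v (j + size u) (th + turn u j).
Proof.
elim: u j th => [|a u IH] j th /=; first by rewrite add0r addn0 addr0.
by rewrite IH -!addrA addSnnS.
Qed.

Lemma trace_cat u v j th :
  trace (u ++ v) j th = trace u j th `|`
    [set disp u j th + x | x in trace v (j + size u) (th + turn u j)].
Proof.
elim: u j th => [|a u IH] j th /=.
  rewrite set0U addn0 addr0; under eq_imagel do rewrite add0r.
  by rewrite image_id.
rewrite IH image_setU setUA image_comp addrA addSnnS; congr (_ `|` _).
by apply: eq_imagel => x _ /=; rewrite addrA.
Qed.

Lemma odd_letter_turn a j j' : odd j = odd j' ->
  letter_turn a j = letter_turn a j'.
Proof. by rewrite /letter_turn => ->. Qed.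

Lemma odd_turn w j j' : odd j = odd j' -> turn w j = turn w j'.
Proof.
elim: w j j' => //= a w IH j j' jj'.
by rewrite (odd_letter_turn a jj') (IH j.+1 j'.+1)//= jj'.
Qed.

Lemma odd_disp w j j' th : odd j = odd j' -> disp w j th = disp w j' th.
Proof.
elim: w j j' th => //= a w IH j j' th jj'.
by rewrite (odd_letter_turn a jj') (IH j.+1 j'.+1)//= jj'.
Qed.

Lemma odd_trace w j j' th : odd j = odd j' -> trace w j th = trace w j' th.
Proof.
elim: w j j' th => //= a w IH j j' th jj'.
by rewrite (odd_letter_turn a jj') (IH j.+1 j'.+1)//= jj'.
Qed.

Lemma letter_turnS a j : letter_turn a j.+1 = - letter_turn a j.
Proof.
by rewrite /letter_turn /=; case: a; case: odd; rewrite ?oppr0 ?opprK.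
Qed.

Lemma turnS w j : turn w j.+1 = - turn w j.
Proof.
by elim: w j => [|a w IH] j /=; rewrite ?oppr0// IH letter_turnS opprD.
Qed.

(** Only the parity of [j] matters, and changing it negates the turn, so index 1 decides. *)
Lemma turn_eq w w' : turn w 1 = turn w' 1 -> forall j, turn w j = turn w' j.
Proof.
move=> ww' j; have [jo|je] := boolP (odd j).
  by rewrite !(@odd_turn _ j 1).
rewrite !(@odd_turn _ j 0) ?(negbTE je)//.
by apply: oppr_inj; rewrite -!turnS.
Qed.

Lemma norm_pair x : `|x| = Num.max `|x.1| `|x.2|.
Proof. by []. Qed.

Definition rotate th x : R * R :=
  (cos th * x.1 - sin th * x.2, sin th * x.1 + cos th * x.2).

Definition mirror x : R * R := (x.1, - x.2).

Lemma disp_rotate w j th th' : disp w j (th + th') = rotate th (disp w j th').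
Proof.
elim: w j th' => [|a w IH] j th' /=.
  by rewrite /rotate /= !mulr0 subr0 addr0.
rewrite -addrA IH /rotate cosD sinD /=; congr pair => /=; ring.
Qed.

(** Shifting the index by one exchanges left and right turns, which reflects the path in the first
    axis. *)
Lemma disp_mirror w j th : disp w j.+1 (- th) = mirror (disp w j th).
Proof.
elim: w j th => [|a w IH] j th /=; first by rewrite /mirror /= oppr0.
rewrite letter_turnS -opprD IH cosN sinN /mirror /=; congr pair => /=.
by rewrite opprD.
Qed.

(** The norm on pairs is the sup norm, which rotations do not preserve; a crude factor 2 is
    enough. *)
Lemma norm_rotate th x : `|rotate th x| <= 2 * `|x|.
Proof.
have B (a b c d : R) : `|a| <= 1 -> `|b| <= 1 -> `|c| <= `|x| -> `|d| <= `|x| ->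
    `|a * c| + `|b * d| <= 2 * `|x|.
  move=> a1 b1 cx dx; rewrite mulrDl mul1r !normrM lerD//.
    by rewrite -[leRHS]mul1r ler_pM.
  by rewrite -[leRHS]mul1r ler_pM.
have x1 : `|x.1| <= `|x| by rewrite [leRHS]norm_pair le_max lexx.
have x2 : `|x.2| <= `|x| by rewrite [leRHS]norm_pair le_max lexx orbT.
have C : `|cos th| <= 1 by rewrite ler_norml cos_geN1 cos_le1.
have S : `|sin th| <= 1 by rewrite ler_norml sin_geN1 sin_le1.
rewrite [leLHS]norm_pair /= ge_max.
by rewrite (le_trans (ler_normB _ _)) ?B//= (le_trans (ler_normD _ _)) ?B.
Qed.

Lemma norm_mirror x : `|mirror x| = `|x|.
Proof. by rewrite !norm_pair /= normrN. Qed.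

Lemma norm_dir th : `|(cos th, sin th) : R * R| <= 1.
Proof.
by rewrite norm_pair /= ge_max !ler_norml cos_geN1 cos_le1 sin_geN1 sin_le1.
Qed.

Lemma trace_norm w j th x : trace w j th x -> `|x| <= (size w)%:R.
Proof.
elim: w j th x => //= a w IH j th x [[t /andP[t0 t1] <-]|[y /IH ysz <-]].
  rewrite normrZ ger0_norm// (@le_trans _ _ 1) ?ler1n//.
  by rewrite -[leRHS]mulr1 ler_pM// norm_dir.
by rewrite (le_trans (ler_normD _ _))// -natr1 addrC lerD// norm_dir.
Qed.

Lemma trace0 w j th : w != [::] -> trace w j th 0.
Proof.
by case: w => //= a w _; left; exists 0; rewrite ?scale0r//= lexx ler01.
Qed.

Lemma segmentE (p q x : R * R) :
  segment p q x <-> exists2 t : R, 0 <= t <= 1 & x = p + t *: (q - p).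
Proof. by split=> [[t []]|[t t01 ->]]; [exists t|exists t]. Qed.

Lemma segment_verts w j p th x :
  (exists k, (k < size w)%N /\
     segment (nth (0, 0) (p :: verts alpha w j p th) k)
             (nth (0, 0) (p :: verts alpha w j p th) k.+1) x) <->
  trace w j th (x - p).
Proof.
elim: w j p th => [|a w IH] j p th /=; first by split=> [[k []]|].
set q := (p.1 + _, _); set th' := if a then _ else _.
have qE : q = p + (cos th, sin th) by [].
have th'E : th' = th + letter_turn a j.
  by rewrite /th' /letter_turn; case: (a); case: odd; rewrite ?addr0.
have {}IH := IH j.+1 q th'.
split=> [[[|k] [ksz]] /=|].
- move=> /segmentE[t t01 ->]; left; exists t => //=.
  have pK (z : R * R) : p + z - p = z by rewrite addrAC subrr add0r.
  by rewrite qE !pK.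
- move=> sx; right; exists (x - q); last first.
    by rewrite qE opprD addrCA [X in _ + X]addrCA subrr addr0.
  by rewrite -th'E; apply/IH; exists k.
- case=> [[t t01 tx]|[y yT yx]].
    exists 0%N; split=> //=; apply/segmentE; exists t => //.
    by rewrite qE [p + _ - _]addrAC subrr add0r tx addrC subrK.
  have /IH [k [ksz sx]] : trace w j.+1 th' (x - q).
    by rewrite th'E qE opprD addrA -yx [_ + y]addrC addrK.
  by exists k.+1.
Qed.

Lemma curve_trace w : curve alpha w = trace w 1 (pi / 2).
Proof.
apply/seteqP; split=> x.
  by move=> /(segment_verts w 1 (0, 0) (pi / 2)); rewrite subr0.
by move=> xT; apply/(segment_verts w 1 (0, 0) (pi / 2)); rewrite subr0.
Qed.

Lemma last_verts w j p th :
  last p (verts alpha w j p th) = p + disp w j th.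
Proof.
elim: w j p th => [|a w IH] j p th /=; first by rewrite addr0.
rewrite IH [in RHS]addrA; congr (_ + disp _ _ _).
by rewrite /letter_turn; case: a; case: odd; rewrite ?addr0.
Qed.

End Trace.

(** * Sequences of sets with geometrically decreasing Hausdorff distances *)

Section GeometricHausdorff.
Variable R : realType.
Implicit Types (A B : set (R * R)) (x y : R * R) (C d e : R) (k m : nat).

Lemma half_expS k : 2 ^- k = 2 * 2 ^- k.+1 :> R.
Proof. by rewrite exprS invfM mulrA divff ?mul1r// pnatr_eq0. Qed.

Lemma half_exp_gt0 k : 0 < 2 ^- k :> R.
Proof. by rewrite invr_gt0 exprn_gt0. Qed.

Lemma half_exp_small C e : 0 <= C -> 0 < e ->
  exists N, forall k, (N <= k)%N -> C * 2 ^- k <= e.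
Proof.
move=> C0 e0.
exists (Num.bound (C / e)) => k Nk.
have Ck : C / e <= 2 ^+ k.
  rewrite (le_trans (ltW (archi_boundP _)))// ?divr_ge0 ?(ltW e0)//.
  rewrite -natrX ler_nat (leq_trans Nk)// ltnW// ltn_expl//.
by rewrite ler_pdivrMr ?exprn_gt0// mulrC -ler_pdivrMr.
Qed.

Lemma geometric_limit (u : nat -> R) C :
  (forall k, `|u k.+1 - u k| <= C * 2 ^- k) ->
  exists l, forall k, `|u k - l| <= 2 * C * 2 ^- k.
Proof.
move=> uC.
(* Since [2 * C * 2 ^- k] is the sum of the bounds on all steps from [k] on, the intervals
   [[b k, a k]] are nested. *)
pose a k := u k + 2 * C * 2 ^- k; pose b k := u k - 2 * C * 2 ^- k.
have step k : a k.+1 <= a k /\ b k <= b k.+1.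
  have := uC k; rewrite /a /b ler_distl half_expS.
  by move: (2 ^- k.+1) => h /andP[]; split; lra.
have a_dec k m : a (k + m)%N <= a k.
  elim: m => [|m IH]; first by rewrite addn0.
  by rewrite addnS (le_trans _ IH)//; case: (step (k + m)%N).
have b_inc k m : b k <= b (k + m)%N.
  elim: m => [|m IH]; first by rewrite addn0.
  by rewrite addnS (le_trans IH)//; case: (step (k + m)%N).
have ba k : b k <= a k.
  rewrite /a /b; have := uC k; have := normr_ge0 (u k.+1 - u k).
  by move=> + /(le_trans _) h => /h; lra.
have ba' k m : b k <= a m.
  have [/subnK <-|/ltnW/subnK <-] := leqP k m.
    by rewrite addnC (le_trans (b_inc k _) (ba _)).
  by rewrite addnC (le_trans (ba _))// a_dec.
have bS : has_sup (range b).
  by split; [exists (b 0%N), 0%N|exists (a 0%N) => _ [k _ <-]].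
exists (sup (range b)) => k.
have h1 : b k <= sup (range b) by apply: ub_le_sup; [exact: bS.2|exists k].
have h2 : sup (range b) <= a k.
  by apply: ge_sup => [|_ [m _ <-]//]; exact: bS.1.
by rewrite ler_distl; rewrite /a /b in h1 h2; lra.
Qed.

Lemma geometric_limit2 (u : nat -> R * R) C :
  (forall k, `|u k.+1 - u k| <= C * 2 ^- k) ->
  exists l, forall k, `|u k - l| <= 2 * C * 2 ^- k.
Proof.
move=> uC.
have [l1 h1] : exists l, forall k, `|(u k).1 - l| <= 2 * C * 2 ^- k.
  apply: geometric_limit => k; apply: le_trans (uC k).
  by rewrite [leRHS]norm_pair le_max lexx.
have [l2 h2] : exists l, forall k, `|(u k).2 - l| <= 2 * C * 2 ^- k.
  apply: geometric_limit => k; apply: le_trans (uC k).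
  by rewrite [leRHS]norm_pair le_max lexx orbT.
by exists (l1, l2) => k; rewrite norm_pair /= ge_max h1 h2.
Qed.

Definition within_dist d A B := forall x, A x -> exists2 y, B y & `|x - y| <= d.

Lemma within_dist_trans d e A B D :
  within_dist d A B -> within_dist e B D -> within_dist (d + e) A D.
Proof.
move=> AB BD x /AB[y /BD[z Dz yz] xy]; exists z => //.
by rewrite -(subrK y x) -addrA (le_trans (ler_normD _ _))// lerD.
Qed.

Lemma within_dist_le d e A B : d <= e -> within_dist d A B -> within_dist e A B.
Proof. by move=> de AB x /AB[y By xy]; exists y => //; exact: le_trans de. Qed.

Lemma edist_le x y : Defs.edist x y <= 2 * `|x - y|.
Proof.
have n0 : 0 <= 2 * `|x - y| by rewrite mulr_ge0.
rewrite -[leRHS]ger0_norm// -sqrtr_sqr ler_wsqrtr//.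
have h1 : `|x.1 - y.1| <= `|x - y| by rewrite [leRHS]norm_pair le_max lexx.
have h2 : `|x.2 - y.2| <= `|x - y| by rewrite [leRHS]norm_pair le_max lexx orbT.
have g1 := ler_pM (normr_ge0 _) (normr_ge0 _) h1 h1.
have g2 := ler_pM (normr_ge0 _) (normr_ge0 _) h2 h2.
rewrite -!expr2 !real_normK ?num_real// in g1 g2.
have : 0 <= `|x - y| ^+ 2 by rewrite sqr_ge0.
move: g1 g2; rewrite !expr2; move: (`|x - y|) => n; lra.
Qed.

Variables (X : nat -> set (R * R)) (C M : R).
Hypothesis X0 : forall k, X k !=set0.
Hypothesis XM : forall x, X 0 x -> `|x| <= M.
Hypothesis Xfwd : forall k, within_dist (C * 2 ^- k) (X k) (X k.+1).
Hypothesis Xbwd : forall k, within_dist (C * 2 ^- k) (X k.+1) (X k).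

Lemma geometric_ge0 : 0 <= C.
Proof.
have [x /Xfwd[y _ xy]] := X0 0.
by rewrite (le_trans (normr_ge0 (x - y)))// (le_trans xy)// expr0 invr1 mulr1.
Qed.

(** The bound is the exact sum of [C * 2 ^- i] over [k <= i < k + m]. *)
Lemma geometric_back k m :
  within_dist (2 * C * (2 ^- k - 2 ^- (k + m))) (X (k + m)%N) (X k).
Proof.
elim: m => [|m IH].
  move=> x; rewrite addn0 subrr mulr0 => xk.
  by exists x => //; rewrite subrr normr0.
rewrite addnS.
have := within_dist_trans (@Xbwd (k + m)%N) IH.
apply: within_dist_le; rewrite (half_expS (k + m)%N).
by move: (2 ^- (k + m).+1) (2 ^- k) => h h'; lra.
Qed.

Lemma geometric_bounded k x : X k x -> `|x| <= M + 2 * C.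
Proof.
rewrite -[k]add0n => /(geometric_back)[y /XM yM xy].
rewrite -(subrK y x) (le_trans (ler_normD _ _))// addrC lerD//.
rewrite (le_trans xy)// expr0 invr1 mulrBr mulr1 gerBl.
by rewrite mulr_ge0 ?mulr_ge0 ?geometric_ge0// ltW// half_exp_gt0.
Qed.

Lemma geometric_orbit k x : X k x -> exists u : nat -> R * R,
  [/\ u 0%N = x, forall m, X (k + m)%N (u m) &
      forall m, `|u m.+1 - u m| <= C * 2 ^- k * 2 ^- m].
Proof.
move=> kx.
have [f fP] : exists f : nat * (R * R) -> R * R, forall p, X p.1 p.2 ->
    X p.1.+1 (f p) /\ `|p.2 - f p| <= C * 2 ^- p.1.
  have /choice[f fP] : forall p : nat * (R * R), exists y, X p.1 p.2 ->
    X p.1.+1 y /\ `|p.2 - y| <= C * 2 ^- p.1.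
    move=> [m y] /=; have [/Xfwd[z ? ?]|] := pselect (X m y); first by exists z.
    (* [choice] needs a total function; outside [X] any value serves. *)
    by exists 0.
  by exists f.
pose u := fix u m := if m is m'.+1 then f (k + m', u m')%N else x.
have uX m : X (k + m)%N (u m).
  elim: m => [|m IH]; first by rewrite addn0.
  by rewrite addnS; case: (fP (k + m, u m)%N IH).
exists u; split=> // m.
case: (fP (k + m, u m)%N (uX m)) => /= _; rewrite distrC.
by rewrite exprD invfM mulrA.
Qed.

(* The bound in [K] is relaxed by an arbitrary [e > 0], which makes [K] closed
   without assuming that the [X k] are closed. *)
Lemma geometric_hausdorff_converges : hausdorff_converges X.
Proof.
pose K := [set x | forall k e, 0 < e ->
  exists2 y, X k y & `|x - y| <= 2 * C * 2 ^- k + e].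
have C0 := geometric_ge0.
have orbit_limit k x : X k x -> exists2 y, K y & `|x - y| <= 2 * C * 2 ^- k.
  move=> kx; have [u [u0 uX uC]] := geometric_orbit kx.
  have [l ul] := geometric_limit2 uC.
  exists l; last by have := ul 0%N; rewrite u0 expr0 invr1 mulr1 mulrA.
  move=> k' e e0.
  (* At later indices the orbit itself is close to [l]. At earlier ones one walks back from [x], and
     the two bounds telescope to [2 * C * 2 ^- k']. *)
  have [kk'|/ltnW kk'] := leqP k k'.
    exists (u (k' - k)%N); first by have := uX (k' - k)%N; rewrite subnKC.
    rewrite distrC (le_trans (ul _))// mulrA -mulrA -invfM -exprD subnKC//.
    by rewrite lerDl ltW.
  have := @geometric_back k' (k - k')%N.
  rewrite subnKC// => /(_ x kx)[y k'y xy].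
  exists y => //; rewrite -(subrK x l) -addrA (le_trans (ler_normD _ _))//.
  have := ul 0%N; rewrite u0 expr0 invr1 mulr1 mulrA distrC.
  by move: xy e0; rewrite mulrBr; lra.
exists K; split; last split.
- pose L := M + 2 * C + 1 + 2 * C.
  have KL z : K z -> `|z| <= L.
    move=> /(_ 0%N 1 ltr01)[t /geometric_bounded tM]; rewrite expr0 invr1 mulr1.
    move=> zt; rewrite -(subrK t z) (le_trans (ler_normD _ _))//.
    by rewrite /L; move: tM zt; lra.
  have cL : compact (`[- L, L] `*` `[- L, L] : set (R * R)).
    by apply: compact_setX; exact: segment_compact.
  apply: (subclosed_compact _ cL); last first.
    move=> z /KL; rewrite norm_pair ge_max => /andP[z1 z2].
    by split; rewrite /= in_itv /= -ler_norml.
  move=> z clz k e e0.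
  have e20 : 0 < e / 2 by rewrite divr_gt0.
  have [t [Kt]] := clz _ (nbhsx_ballx z (e / 2) e20).
  rewrite -ball_normE /= => zt.
  have [y ky ty] := Kt k _ e20.
  exists y => //; rewrite -(subrK t z) -addrA (le_trans (ler_normD _ _))//.
  by move: zt ty; lra.
- by have [x /orbit_limit[y Ky _]] := X0 0; exists y.
- move=> e e0.
  (* The outer factor 2 comes from [edist_le]; the extra 1 pays for the slack in [K], taken to be
     [2 ^- k]. *)
  have C2 : 0 <= 2 * (2 * C + 1) by move: C0; lra.
  have [N Ne] := half_exp_small C2 e0.
  exists N => k /Ne ke; have h := half_exp_gt0 k; split.
    move=> x /orbit_limit[y Ky xy]; exists y => //.
    by rewrite (le_trans (edist_le _ _)); move: xy ke h; lra.
  move=> y /(_ k _ h)[x kx xy]; exists x => //.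
  rewrite (le_trans (edist_le _ _))// distrC.
  by move: xy ke h; lra.
Qed.

End GeometricHausdorff.

(** * Euclidean length: triangle inequality and homogeneity *)

Section EuclideanNorm.
Variable R : realType.
Implicit Types x y : R * R.

Lemma edist0D x y : Defs.edist (0, 0) (x + y) <=
  Defs.edist (0, 0) x + Defs.edist (0, 0) y.
Proof.
rewrite /Defs.edist /= !sub0r !sqrrN.
set a := Num.sqrt (x.1 ^+ 2 + _); set b := Num.sqrt (y.1 ^+ 2 + _).
have a0 : 0 <= a by exact: sqrtr_ge0.
have b0 : 0 <= b by exact: sqrtr_ge0.
have aE : a ^+ 2 = x.1 ^+ 2 + x.2 ^+ 2 by rewrite sqr_sqrtr ?addr_ge0 ?sqr_ge0.
have bE : b ^+ 2 = y.1 ^+ 2 + y.2 ^+ 2 by rewrite sqr_sqrtr ?addr_ge0 ?sqr_ge0.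
have CS : x.1 * y.1 + x.2 * y.2 <= a * b.
  apply: le_trans (ler_norm _) _.
  rewrite -(ler_pXn2r (n := 2)) ?nnegrE ?mulr_ge0// real_normK ?num_real//.
  rewrite exprMn aE bE -subr_ge0.
  (* Lagrange's identity: the defect in Cauchy-Schwarz is a square. *)
  rewrite [X in 0 <= X](_ : _ = (x.1 * y.2 - x.2 * y.1) ^+ 2) ?sqr_ge0//; ring.
rewrite -[leRHS]ger0_norm ?addr_ge0// -sqrtr_sqr ler_wsqrtr//.
move: CS; rewrite [(a + b) ^+ 2]sqrrD aE bE /= !expr2; lra.
Qed.

Lemma edist0_lipschitz x y :
  `|Defs.edist (0, 0) x - Defs.edist (0, 0) y| <= 2 * `|x - y|.
Proof.
have E (z : R * R) : Defs.edist (0, 0) z <= 2 * `|z|.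
  by rewrite (le_trans (edist_le _ _))// [(0, 0) - z]sub0r normrN.
have := edist0D (x - y) y; have := edist0D (y - x) x.
rewrite !subrK ler_distl; have := E (x - y); have := E (y - x).
rewrite distrC; lra.
Qed.

Lemma edist0Z (c : R) x : 0 <= c ->
  Defs.edist (0, 0) (c *: x) = c * Defs.edist (0, 0) x.
Proof.
move=> c0; rewrite /Defs.edist /= !sub0r !sqrrN.
rewrite -[X in _ = X * _](ger0_norm c0) -sqrtr_sqr -sqrtrM ?sqr_ge0//.
by rewrite mulrDr -!exprMn.
Qed.

End EuclideanNorm.

(** * Six-step self-similarity *)

Section SelfSimilar.
Variables (R : realType) (alpha : R) (g : nat -> seq bool) (L C : R).
Hypothesis gS : forall n, g n.+2 = g n.+1 ++ g n.
Hypothesis g_neq0 : forall n, g n != [::].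
Hypothesis g_odd : forall n, odd (size (g (n + 6)%N)) = odd (size (g n)).
Hypothesis g_turn : forall n, turn alpha (g (n + 6)%N) 1 = turn alpha (g n) 1.
Hypothesis L_ge4 : 4 <= L.
Hypothesis g_disp : forall n j th,
  `|disp alpha (g (n + 6)%N) j th - L *: disp alpha (g n) j th| <= C.

Let z n := disp alpha (g n).
Let S n := trace alpha (g n).

Lemma trace_step n j th : S n.+2 j th = S n.+1 j th `|`
  [set z n.+1 j th + x | x in
    S n (j + size (g n.+1)) (th + turn alpha (g n.+1) j)].
Proof. by rewrite /S gS trace_cat. Qed.

(** Parity and turn repeat after six steps, so the second piece is drawn with the same index parity
    and direction as six steps earlier; its translation alone is new. *)
Lemma trace_step_period n j th : S (n.+2 + 6)%N j th = S (n.+1 + 6)%N j th `|`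
  [set z (n.+1 + 6)%N j th + x | x in
    S (n + 6)%N (j + size (g n.+1)) (th + turn alpha (g n.+1) j)].
Proof.
rewrite [(n.+2 + 6)%N]addSn [(n.+1 + 6)%N]addSn trace_step -[(n + 6).+1]addSn.
rewrite (turn_eq (g_turn n.+1)); congr (_ `|` image _ _).
by apply: odd_trace; rewrite !oddD g_odd.
Qed.

Let C_ge0 : 0 <= C.
Proof. exact: le_trans (g_disp 0 0 0). Qed.

(** Uniform in index and direction, because the second factor of a concatenation starts from values
    other than [j] and [th]. *)
Let close d n := forall j th,
  within_dist d (S (n + 6)%N j th) [set L *: x | x in S n j th] /\
  within_dist d [set L *: x | x in S n j th] (S (n + 6)%N j th).

(** The first factor costs [d], the second [e] plus the error [C] of its translation; for a union
    the larger cost counts. *)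
Lemma trace_close_step d e n : d <= e + C ->
  close d n.+1 -> close e n -> close (e + C) n.+2.
Proof.
move=> de cd ce j th.
have [d1 d2] := cd j th.
have [e1 e2] := ce (j + size (g n.+1))%N (th + turn alpha (g n.+1) j).
have zC := g_disp n.+1 j th.
rewrite trace_step_period trace_step; split.
- move=> x [/d1[_ [y yS <-] xy]|[t /e1[_ [y yS <-] ty] <-]].
    by exists (L *: y); [exists y => //; left|exact: le_trans de].
  exists (L *: (z n.+1 j th + y)).
    by exists (z n.+1 j th + y) => //; right; exists y.
  rewrite scalerDr opprD addrACA (le_trans (ler_normD _ _))// [leRHS]addrC.
  exact: lerD.
- move=> _ [x [xS|[y yS <-]] <-].
    have [|y yS xy] := d2 (L *: x); first by exists x.
    by exists y; [left|exact: le_trans de].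
  have [|t tS yt] := e2 (L *: y); first by exists y.
  exists (z (n.+1 + 6)%N j th + t); first by right; exists t.
  rewrite scalerDr opprD addrACA (le_trans (ler_normD _ _))//.
  rewrite [leRHS]addrC lerD//.
  by rewrite distrC.
Qed.

(** Both sets contain the origin, so the sum of their radii is a crude bound; it starts the
    induction. *)
Let size_close n : close ((size (g (n + 6)%N))%:R + L * (size (g n))%:R) n.
Proof.
have L0 : 0 <= L by rewrite (le_trans _ L_ge4).
have lS x j th : S n j th x -> `|L *: x| <= L * (size (g n))%:R.
  by move=> /trace_norm xn; rewrite normrZ ger0_norm// ler_wpM2l.
move=> j th; split.
- move=> x /trace_norm xn; exists (L *: 0).
    by exists 0 => //; exact: trace0.
  rewrite scaler0 subr0 (le_trans xn)// lerDl mulr_ge0//.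
- move=> _ [x /lS xn <-]; exists 0; first exact: trace0.
  by rewrite subr0 (le_trans xn)// lerDr.
Qed.

(* The error of the approximate dilation by [L] is not amplified by
   concatenation, so it grows only linearly while the curves grow like [L^k]. *)
Lemma trace_close : exists2 D, 0 <= D & forall n, close (D + C * n%:R) n.
Proof.
have L0 : 0 <= L by rewrite (le_trans _ L_ge4).
pose d n : R := (size (g (n + 6)%N))%:R + L * (size (g n))%:R.
have d0 n : 0 <= d n by rewrite addr_ge0// mulr_ge0.
exists (d 0%N + d 1%N); first by rewrite addr_ge0.
have mono a b n : a <= b -> close a n -> close b n.
  move=> ab ca j th; have [c1 c2] := ca j th.
  by split; [exact: within_dist_le c1|exact: within_dist_le c2].
move=> n; suff [] : close (d 0%N + d 1%N + C * n%:R) n /\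
  close (d 0%N + d 1%N + C * n.+1%:R) n.+1 by [].
elim: n => [|n [IH1 IH2]].
  split; [apply: mono (size_close 0)|apply: mono (size_close 1)].
    by rewrite mulr0 addr0 lerDl.
  by rewrite mulr1 -addrA addrCA lerDl addr_ge0.
by split=> //; apply: mono (trace_close_step _ IH2 IH1);
  rewrite -!natr1; move: C_ge0; lra.
Qed.

Variables (r : nat) (delta : R).
Hypothesis delta_gt0 : 0 < delta.
Hypothesis g_growth : forall k, delta * L ^+ k <=
  Defs.edist (0, 0) (disp alpha (g (6 * k + r)%N) 1 (pi / 2)).

Let X k := [set L ^- k *: x | x in S (6 * k + r)%N 1 (pi / 2)].
Let V k := Defs.edist (0, 0) (L ^- k *: z (6 * k + r)%N 1 (pi / 2)).

Let L_gt0 : 0 < L. Proof. exact: lt_le_trans L_ge4. Qed.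

Let Lk_ge0 k : 0 <= L ^- k.
Proof. by rewrite invr_ge0 exprn_ge0// ltW. Qed.

Lemma scale_expS k (x y : R * R) :
  L ^- k.+1 *: x - L ^- k *: y = L ^- k.+1 *: (x - L *: y).
Proof.
rewrite scalerBr scalerA exprSr invfM -mulrA mulVf ?mulr1//.
by rewrite gt_eqF.
Qed.

(** One factor [2 ^- k] will absorb the linear growth of the error; the other remains as the
    geometric rate. *)
Lemma exp_ge4_half_exp k : L ^- k.+1 <= 2 ^- k * 2 ^- k.
Proof.
have L1 : 1 <= L by apply: le_trans L_ge4; rewrite ler1n.
rewrite -invfM -exprMn lef_pV2 ?posrE ?exprn_gt0 ?mulr_gt0//.
rewrite exprSr (@le_trans _ _ (L ^+ k))//.
  by rewrite lerXn2r ?nnegrE ?mulr_ge0 ?(ltW L_gt0)// -natrM.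
by rewrite ler_peMr// exprn_ge0// ltW.
Qed.

Let X_close : exists D, forall k,
  within_dist (D * 2 ^- k) (X k) (X k.+1) /\
  within_dist (D * 2 ^- k) (X k.+1) (X k).
Proof.
have [D D0 cl] := trace_close.
exists (D + C * (6 + r)%:R) => k.
have dE : L ^- k.+1 * (D + C * (6 * k + r)%:R) <= (D + C * (6 + r)%:R) * 2 ^- k.
  (* A linear function of [k] is dominated by a multiple of [2 ^+ k], since [k < 2 ^ k]. *)
  have h : D + C * (6 * k + r)%:R <= (D + C * (6 + r)%:R) * 2 ^+ k.
    rewrite mulrDl lerD//; first by rewrite ler_peMr// exprn_ege1// ler1n.
    rewrite -mulrA ler_wpM2l// -natrX -natrM ler_nat mulnDl leq_add//.
      by rewrite leq_mul2l /= ltnW// ltn_expl.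
    by rewrite leq_pmulr// expn_gt0.
  rewrite (le_trans (ler_pM _ _ (exp_ge4_half_exp k) h))//.
    by rewrite addr_ge0// mulr_ge0.
  by rewrite mulrACA mulVf ?expf_neq0 ?pnatr_eq0// mulr1 mulrC.
have kS : (6 * k.+1 + r = 6 * k + r + 6)%N by rewrite mulnS -addnA addnC.
have dist (x y : R * R) : `|x - L *: y| <= D + C * (6 * k + r)%:R ->
    `|L ^- k.+1 *: x - L ^- k *: y| <= (D + C * (6 + r)%:R) * 2 ^- k.
  move=> xy; apply: le_trans dE.
  by rewrite scale_expS normrZ ger0_norm// ler_wpM2l.
have [c1 c2] := cl (6 * k + r)%N 1%N (pi / 2).
rewrite /X kS; split.
- move=> _ [x xS <-]; have [|y yS xy] := c2 (L *: x); first by exists x.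
  exists (L ^- k.+1 *: y); first by exists y.
  by rewrite distrC dist// distrC.
- move=> _ [x /c1[_ [y yS <-] xy] <-].
  by exists (L ^- k *: y); [exists y|exact: dist].
Qed.

Let V_ge k : delta <= V k.
Proof.
by rewrite /V edist0Z// mulrC ler_pdivlMr ?exprn_gt0.
Qed.

Let V_close k : `|V k.+1 - V k| <= 2 * C * 2 ^- k.
Proof.
rewrite (le_trans (edist0_lipschitz _ _))// -mulrA ler_wpM2l//.
rewrite scale_expS normrZ ger0_norm//.
have -> : (6 * k.+1 + r = 6 * k + r + 6)%N by rewrite mulnS -addnA addnC.
rewrite [leRHS]mulrC ler_pM ?g_disp//.
apply: le_trans (exp_ge4_half_exp k) _.
rewrite ler_piMr ?invr_ge0 ?exprn_ge0// invf_le1 ?exprn_gt0//.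
by rewrite exprn_ege1// ler1n.
Qed.

(** The powers of [L] cancel, since [V k] is the width of the curve already scaled by [L ^- k]. *)
Lemma dilate_curve k :
  dilate (Num.sqrt 2 / Defs.edist (0, 0)
            (last (0, 0) (vertices alpha (g (6 * k + r)%N))))
         (curve alpha (g (6 * k + r)%N)) =
  [set (Num.sqrt 2 / V k) *: x | x in X k].
Proof.
rewrite curve_trace /vertices /= last_verts add0r /V edist0Z// /X image_comp.
rewrite /dilate; apply: eq_imagel => x _ /=.
rewrite scalerA; set W := Defs.edist _ _.
rewrite -[LHS]/((Num.sqrt 2 / W) *: x); congr (_ *: x).
rewrite invfM invrK -mulrA [X in _ = _ * X]mulrAC mulfV ?mul1r//.
by rewrite expf_neq0// gt_eqF.
Qed.

(** The sets [X k] converge geometrically, and so do the factors [Num.sqrt 2 / V k], as [V k] stays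
    above [delta]; hence so do the products. *)
Lemma self_similar_converges : hausdorff_converges (fun k =>
  dilate (Num.sqrt 2 / Defs.edist (0, 0)
            (last (0, 0) (vertices alpha (g (6 * k + r)%N))))
         (curve alpha (g (6 * k + r)%N))).
Proof.
have [D XD] := X_close.
have X0 k : X k !=set0 by exists (L ^- k *: 0), 0 => //; exact: trace0.
have XM x : X 0 x -> `|x| <= (size (g r))%:R.
  by move=> [y + <-]; rewrite expr0 invr1 scale1r => /trace_norm.
have D0 : 0 <= D := geometric_ge0 X0 (fun k => (XD k).1).
have XB k x : X k x -> `|x| <= (size (g r))%:R + 2 * D.
  exact: (geometric_bounded X0 XM (fun k => (XD k).1) (fun k => (XD k).2)).
set B := _ + _ in XB.
have B0 : 0 <= B by rewrite addr_ge0// mulr_ge0.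
rewrite (_ : (fun k => _) = fun k => [set (Num.sqrt 2 / V k) *: x | x in X k]);
  last by apply/funext => k; exact: dilate_curve.
have V0 k : 0 < V k by exact: lt_le_trans (V_ge k).
have s0 : 0 <= Num.sqrt 2 :> R by exact: sqrtr_ge0.
(* First summand: a point moves while the factor stays below [Num.sqrt 2 / delta]. Second: the
   factor changes at points of norm at most [B]. *)
pose E := Num.sqrt 2 / delta * D + Num.sqrt 2 / delta ^+ 2 * (2 * C) * B.
have Vinv k : Num.sqrt 2 / V k <= Num.sqrt 2 / delta.
  by rewrite ler_wpM2l// lef_pV2 ?posrE.
have VinvB k : `|Num.sqrt 2 / V k.+1 - Num.sqrt 2 / V k| <=
    Num.sqrt 2 / delta ^+ 2 * (2 * C) * 2 ^- k.
  have -> : Num.sqrt 2 / V k.+1 - Num.sqrt 2 / V k =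
      Num.sqrt 2 / (V k.+1 * V k) * - (V k.+1 - V k).
    by field; rewrite !gt_eqF.
  rewrite normrM normrN -[leRHS]mulrA ler_pM//.
  rewrite ger0_norm ?divr_ge0 ?mulr_ge0 ?(ltW (V0 _))//.
  by rewrite ler_wpM2l// lef_pV2 ?posrE ?mulr_gt0 ?exprn_gt0// ler_pM// ltW.
have dist k (x y : R * R) : X k x -> X k.+1 y -> `|x - y| <= D * 2 ^- k ->
    `|(Num.sqrt 2 / V k) *: x - (Num.sqrt 2 / V k.+1) *: y| <= E * 2 ^- k.
  move=> /XB xB /XB yB xy.
  have -> : (Num.sqrt 2 / V k) *: x - (Num.sqrt 2 / V k.+1) *: y =
      (Num.sqrt 2 / V k) *: (x - y) -
      (Num.sqrt 2 / V k.+1 - Num.sqrt 2 / V k) *: y.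
    by rewrite scalerBr scalerBl opprB addrA subrK.
  rewrite (le_trans (ler_normB _ _))//.
  rewrite [`|_ *: (x - y)|]normrZ [`|_ *: y|]normrZ mulrDl lerD//.
    by rewrite -[leRHS]mulrA ler_pM// ger0_norm// divr_ge0// ltW.
  by rewrite [leRHS]mulrAC ler_pM.
apply: (@geometric_hausdorff_converges _ _ E (Num.sqrt 2 / V 0 * B)).
- by move=> k; have [x xk] := X0 k; exists ((Num.sqrt 2 / V k) *: x), x.
- move=> _ [x /XB xB <-]; rewrite normrZ ger0_norm ?ler_wpM2l//;
    by rewrite divr_ge0// ltW.
- move=> k _ [x xk <-]; have [y yk xy] := (XD k).1 x xk.
  by exists ((Num.sqrt 2 / V k.+1) *: y); [exists y|exact: dist].
- move=> k _ [x xk <-]; have [y yk xy] := (XD k).2 x xk.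
  exists ((Num.sqrt 2 / V k) *: y); first by exists y.
  by rewrite distrC dist// distrC.
Qed.

End SelfSimilar.

(** * The linear recursion governing six steps *)

Section LinearDynamics.
Variables (R : realType) (q L a b : R) (u y v : nat -> R).
Hypothesis q_ge1 : 1 <= q.
Hypothesis L_root : L ^+ 2 = (4 * q ^+ 2 + 2) * L - 1.
Hypothesis L_ge4 : 4 <= L.
Hypothesis L_ge : 2 * q + 1 <= L.
Hypothesis uS : forall k,
  u k.+1 = (4 * q ^+ 2 - 2 * q + 1) * u k + 2 * q ^+ 2 * y k.
Hypothesis yS : forall k, y k.+1 = 4 * q * u k + (2 * q + 1) * y k.
Hypothesis vS : forall k, v k.+1 = v k + a * u k + b * y k.

(** The second eigenvalue, as the trace minus [L]. *)
Let t := 4 * q ^+ 2 + 2 - L.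

Let tL : t * L = 1.
Proof. by rewrite /t mulrBl -expr2 L_root; ring. Qed.

Let t_gt0 : 0 < t.
Proof.
have L0 : 0 < L by exact: lt_le_trans L_ge4.
by rewrite -(pmulr_lgt0 _ L0) tL.
Qed.

Let t_le : t <= 2^-1.
Proof.
have : t * 4 <= 1 by rewrite -[leRHS]tL ler_wpM2l// ltW.
by lra.
Qed.

(* Cayley-Hamilton: with M the matrix of [uS] and [yS], applying M - L to an
   orbit of M leaves only the eigenvalue [t = 1 / L]. *)
Lemma residue_contract (x : nat -> R) :
  (forall k, x k.+2 = (4 * q ^+ 2 + 2) * x k.+1 - x k) ->
  forall k, `|x k.+1 - L * x k| <= `|x 1%N - L * x 0%N| * t ^+ k.
Proof.
move=> xS; elim=> [|k IH]; first by rewrite expr0 mulr1.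
have -> : x k.+2 - L * x k.+1 = (x k.+1 - L * x k) * t.
  have h : L * x k * t = x k by rewrite mulrC mulrA tL mul1r.
  by rewrite xS mulrBl h /t; ring.
by rewrite normrM (gtr0_norm t_gt0) exprSr mulrA ler_wpM2r// ltW.
Qed.

Let uSS k : u k.+2 = (4 * q ^+ 2 + 2) * u k.+1 - u k.
Proof. by rewrite !(uS, yS); ring. Qed.

Let ySS k : y k.+2 = (4 * q ^+ 2 + 2) * y k.+1 - y k.
Proof. by rewrite !(uS, yS); ring. Qed.

Lemma residue_bounded : exists D, forall k, [/\ `|u k.+1 - L * u k| <= D,
  `|y k.+1 - L * y k| <= D & `|v k.+1 - L * v k| <= D].
Proof.
have := residue_contract uSS; have := residue_contract ySS.
set Y := `|y 1 - _|; set U := `|u 1 - _| => ey eu.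
have U0 : 0 <= U by exact: normr_ge0.
have Y0 : 0 <= Y by exact: normr_ge0.
pose G := `|a| * U + `|b| * Y.
have G0 : 0 <= G by rewrite addr_ge0// mulr_ge0.
have tk k : 0 < t ^+ k <= 1.
  rewrite exprn_gt0//= exprn_ile1 ?(ltW t_gt0)//.
  by rewrite (le_trans t_le)// invf_le1// ler1n.
(* The residue of [v] accumulates those of [u] and [y]. The form [1 - t ^+ k] closes the induction
   because [t <= 1 / 2]. *)
have ev k : `|v k.+1 - L * v k| <= `|v 1%N - L * v 0%N| + 2 * G * (1 - t ^+ k).
  elim: k => [|k IH]; first by rewrite expr0 subrr mulr0 addr0.
  have -> : v k.+2 - L * v k.+1 = (v k.+1 - L * v k) +
     (a * (u k.+1 - L * u k) + b * (y k.+1 - L * y k)).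
    by rewrite (vS k.+1) !(vS k); ring.
  have Gk : `|a * (u k.+1 - L * u k) + b * (y k.+1 - L * y k)| <= G * t ^+ k.
    rewrite (le_trans (ler_normD _ _))// !normrM mulrDl -!mulrA.
    by rewrite lerD// ler_wpM2l.
  have Gt : G * t ^+ k.+1 * 2 <= G * t ^+ k.
    rewrite -mulrA ler_wpM2l// exprSr -mulrA ler_piMr ?exprn_ge0 ?(ltW t_gt0)//.
    by move: t_le; lra.
  rewrite (le_trans (ler_normD _ _))// (le_trans (lerD IH Gk))//.
  by move: Gt; lra.
exists (U + Y + (`|v 1%N - L * v 0%N| + 2 * G)) => k.
have /andP[k0 k1] := tk k.
have Ut : U * t ^+ k <= U by rewrite ler_piMr.
have Yt : Y * t ^+ k <= Y by rewrite ler_piMr.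
have Gt : 0 <= G * t ^+ k by rewrite mulr_ge0// ltW.
have v0 := normr_ge0 (v 1%N - L * v 0%N).
by split; [apply: le_trans (eu k) _|apply: le_trans (ey k) _|
  apply: le_trans (ev k) _]; lra.
Qed.

Hypothesis u0 : 0 < u 0%N.
Hypothesis y0 : 0 < y 0%N.

Lemma dynamics_gt0 k : 0 < u k /\ 0 < y k.
Proof.
elim: k => // k [uk yk]; rewrite uS yS.
have q0 : 0 < q by rewrite (lt_le_trans _ q_ge1).
have q1 : 0 < 4 * q ^+ 2 - 2 * q + 1 by move: q_ge1; rewrite expr2; nra.
have q2 : 0 < 2 * q + 1 by move: q0; lra.
by split; apply: addr_gt0; rewrite ?mulr_gt0 ?exprn_gt0.
Qed.

(* [((L - 2 q - 1), 2 q^2)] is a positive left eigenvector of M. *)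
Lemma dynamics_growth : exists2 d, 0 < d & forall k, d * L ^+ k <= u k.
Proof.
pose l k := (L - 2 * q - 1) * u k + 2 * q ^+ 2 * y k.
have q0 : 0 < q by rewrite (lt_le_trans _ q_ge1).
have L0 : 0 < L by exact: lt_le_trans L_ge4.
have l0 : 0 < l 0%N.
  rewrite ltr_wpDl ?mulr_gt0 ?exprn_gt0// mulr_ge0 ?(ltW u0)//.
  by move: L_ge; lra.
have lS k : l k.+1 = L * l k.
  rewrite /l uS yS.
  have -> : L * ((L - 2 * q - 1) * u k + 2 * q ^+ 2 * y k) =
    (L ^+ 2 - 2 * q * L - L) * u k + 2 * q ^+ 2 * L * y k by ring.
  by rewrite L_root; ring.
have lk k : l k = L ^+ k * l 0%N.
  by elim: k => [|k IH]; rewrite ?expr0 ?mul1r// lS IH exprS mulrA.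
(* The coefficients of [u k] in [u k.+1] and in [l k] differ by [t], which is positive. *)
have ul k : l k <= u k.+1.
  have [uk _] := dynamics_gt0 k.
  rewrite uS lerD2r ler_wpM2r ?(ltW uk)//.
  by have := t_gt0; rewrite /t; lra.
(* The minimum covers [k = 0], which the bound on [u k.+1] leaves out. *)
exists (Num.min (u 0%N) (l 0%N / L)); first by rewrite lt_min u0 divr_gt0.
case=> [|k]; first by rewrite expr0 mulr1 ge_min lexx.
rewrite (le_trans _ (ul k))// (lk k) exprSr [leLHS]mulrCA ler_wpM2l//.
  by rewrite exprn_ge0// ltW.
by rewrite -ler_pdivlMr// ge_min lexx orbT.
Qed.

End LinearDynamics.

(** * Displacements of the Fibonacci words *)

Section Drawn.
Variables (R : realType) (alpha : R).
Implicit Types (w : seq bool) (p : bool) (r a b : R).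

(* Drawing the word from an even index mirrors it, so the parity of the length,
   the total turn and the displacement from direction 0 at index 1 determine
   all displacements of a concatenation. *)
Definition drawn w p r a b :=
  [/\ odd (size w) = p, turn alpha w 1 = r & disp alpha w 1 0 = (a, b)].

Lemma drawn_cat_even w w' p r r' a b a' b' :
  drawn w false r a b -> drawn w' p r' a' b' ->
  drawn (w ++ w') p (r + r') (a + (cos r * a' - sin r * b'))
                             (b + (sin r * a' + cos r * b')).
Proof.
move=> [we wr wd] [wp' wr' wd']; split.
- by rewrite size_cat oddD we wp'.
- by rewrite turn_cat wr -wr'; congr (_ + _); apply: odd_turn; rewrite oddD we.
- rewrite disp_cat wd wr add0r -[r]addr0 (@odd_disp _ _ _ _ 1) ?oddD ?we//.
  by rewrite disp_rotate wd' addr0.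
Qed.

(** After an odd number of letters the second word starts at an even index: its turn is negated and
    its displacement is reflected before being rotated by [r]. *)
Lemma drawn_cat_odd w w' p r r' a b a' b' :
  drawn w true r a b -> drawn w' p r' a' b' ->
  drawn (w ++ w') (~~ p) (r - r') (a + (cos r * a' + sin r * b'))
                                  (b + (sin r * a' - cos r * b')).
Proof.
move=> [we wr wd] [wp' wr' wd']; split.
- by rewrite size_cat oddD we wp'.
- rewrite turn_cat wr -wr' -turnS; congr (_ + _).
  by apply: odd_turn; rewrite oddD we.
- rewrite disp_cat wd wr add0r -[r]addr0 (@odd_disp _ _ _ _ 2) ?oddD ?we//.
  rewrite disp_rotate -[X in disp _ _ _ X]oppr0 disp_mirror wd' addr0.
  by rewrite /rotate /mirror /= !mulrN opprK.
Qed.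

Lemma drawn_eq w p r r' a a' b b' :
  drawn w p r a b -> r = r' -> a = a' -> b = b' -> drawn w p r' a' b'.
Proof. by move=> ? <- <- <-. Qed.

(** Direction [pi / 2] is a quarter turn from direction 0, so [a] becomes the second coordinate. *)
Lemma drawn_edist w p r a b : drawn w p r a b ->
  a <= Defs.edist (0, 0) (disp alpha w 1 (pi / 2)).
Proof.
case=> _ _ wd; rewrite -[pi / 2]addr0 disp_rotate wd /rotate /=.
rewrite cos_pihalf sin_pihalf !mul0r !mul1r sub0r addr0.
rewrite /Defs.edist /= !sub0r opprK sqrrN (le_trans (ler_norm _))//.
by rewrite -sqrtr_sqr ler_wsqrtr// lerDr sqr_ge0.
Qed.

(** Changing the parity is a reflection and keeps the sup norm; changing the direction is a rotation
    and costs the factor 2. *)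
Lemma drawn_dispB w w' p p' r r' a a' b b' L C :
  drawn w p r a b -> drawn w' p' r' a' b' ->
  `|a' - L * a| <= C -> `|b' - L * b| <= C ->
  forall j th, `|disp alpha w' j th - L *: disp alpha w j th| <= 2 * C.
Proof.
move=> [_ _ wd] [_ _ wd'] aC bC j th.
rewrite -[th]addr0 !disp_rotate.
have -> (x x' : R * R) :
    rotate th x' - L *: rotate th x = rotate th (x' - L *: x).
  rewrite /rotate; congr pair; rewrite /= /GRing.scale /=; ring.
rewrite (le_trans (norm_rotate _ _))// ler_wpM2l//.
have nC : `|disp alpha w' 1 0 - L *: disp alpha w 1 0| <= C.
  by rewrite wd wd' norm_pair /= ge_max aC bC.
have [jo|je] := boolP (odd j).
  by rewrite !(@odd_disp _ _ _ j 1).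
rewrite !(@odd_disp _ _ _ j 2) ?(negbTE je)// -oppr0 !disp_mirror.
have -> (x x' : R * R) : mirror x' - L *: mirror x = mirror (x' - L *: x).
  by rewrite /mirror; congr pair; rewrite /= /GRing.scale /=; ring.
by rewrite norm_mirror.
Qed.

End Drawn.

(** * Displacements through six consecutive concatenations *)

Section Cycles.
Variables (R : realType) (alpha : R) (g : nat -> seq bool).
Hypothesis gS : forall n, g n.+2 = g n.+1 ++ g n.
Variables (n : nat) (u y v : R).

Let c := cos alpha.
Let s := sin alpha.
Let q := 1 + c.
Let u' := (4 * q ^+ 2 - 2 * q + 1) * u + 2 * q ^+ 2 * y.
Let y' := 4 * q * u + (2 * q + 1) * y.

Let cs m : m * (c * c + s * s) = m.
Proof. by rewrite -!expr2 cos2Dsin2 mulr1. Qed.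

(* [lra] treats monomials as atoms, so it is given the multiples of
   [c * c + s * s = 1] that are needed. *)
Ltac trig_ring := rewrite ?(cosN, sinN, cosD, sinD, cos0, sin0) -/c -/s;
  rewrite ?/u' ?/y' ?/q ?expr2;
  have := cs u; have := cs y; have := cs v;
  have := cs (c * u); have := cs (c * y); have := cs (c * v);
  have := cs (s * u); have := cs (s * y); have := cs (s * v); lra.

(** The displacement of [g n] is [y] along the direction [- alpha]. The coordinate [v] drops out of
    [u'] and [y'] and returns with coefficient 1, which is the extra eigenvalue 1. *)
Lemma even_cycle :
  drawn alpha (g n) true (- alpha) (c * y) (- s * y) ->
  drawn alpha (g n.+1) false alpha u v ->
  drawn alpha (g (n + 6)%N) true (- alpha) (c * y') (- s * y') /\
  drawn alpha (g (n + 6).+1%N) false alpha u' (v - s * (y' + 2 * u + y)).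
Proof.
move=> d0 d1; rewrite !addnS addn0.
have d2 : drawn alpha (g n.+2) true 0 (u + y) v.
  by rewrite gS; apply: drawn_eq (drawn_cat_even d1 d0) _ _ _; trig_ring.
have d3 : drawn alpha (g n.+3) true (- alpha) (2 * u + y) 0.
  by rewrite gS; apply: drawn_eq (drawn_cat_odd d2 d1) _ _ _; trig_ring.
have d4 : drawn alpha (g n.+4) false (- alpha)
    (2 * u + y + c * (u + y) - s * v) (- s * (u + y) - c * v).
  by rewrite gS; apply: drawn_eq (drawn_cat_odd d3 d2) _ _ _; trig_ring.
have d5 : drawn alpha (g n.+4.+1) true (- alpha - alpha)
    (2 * u + y + c * (3 * u + 2 * y) - s * v) (- s * (3 * u + 2 * y) - c * v).
  by rewrite gS; apply: drawn_eq (drawn_cat_even d4 d3) _ _ _; trig_ring.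
have d6 : drawn alpha (g n.+4.+2) true (- alpha) (c * y') (- s * y').
  by rewrite gS; apply: drawn_eq (drawn_cat_odd d5 d4) _ _ _; trig_ring.
split=> //.
by rewrite gS; apply: drawn_eq (drawn_cat_odd d6 d5) _ _ _; trig_ring.
Qed.

(** Here the displacement of [g n] lies on the first axis, but the matrix taking [u, y] to [u', y']
    is that of the even case. *)
Lemma odd_cycle :
  drawn alpha (g n) true (- alpha) y 0 ->
  drawn alpha (g n.+1) true 0 u v ->
  drawn alpha (g (n + 6)%N) true (- alpha) y' 0 /\
  drawn alpha (g (n + 6).+1%N) true 0 u'
    (v - s * (2 * u + 2 * y) - 2 * s * c * (2 * u + y)).
Proof.
move=> d0 d1; rewrite !addnS addn0.
have d2 : drawn alpha (g n.+2) false alpha (u + y) v.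
  by rewrite gS; apply: drawn_eq (drawn_cat_odd d1 d0) _ _ _; trig_ring.
have d3 : drawn alpha (g n.+3) true alpha
    (u + y + c * u - s * v) (v + s * u + c * v).
  by rewrite gS; apply: drawn_eq (drawn_cat_even d2 d1) _ _ _; trig_ring.
have d4 : drawn alpha (g n.+4) true 0
    (u + y + c * (2 * u + y)) (v + s * (2 * u + y)).
  by rewrite gS; apply: drawn_eq (drawn_cat_odd d3 d2) _ _ _; trig_ring.
have d5 : drawn alpha (g n.+4.+1) false (- alpha)
    (2 * (u + y) + c * (3 * u + y) - s * v) (s * (u + y) - c * v).
  by rewrite gS; apply: drawn_eq (drawn_cat_odd d4 d3) _ _ _; trig_ring.
have d6 : drawn alpha (g n.+4.+2) true (- alpha) y' 0.
  by rewrite gS; apply: drawn_eq (drawn_cat_even d5 d4) _ _ _; trig_ring.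
split=> //.
by rewrite gS; apply: drawn_eq (drawn_cat_odd d6 d5) _ _ _; trig_ring.
Qed.

End Cycles.

(** * From one cycle to convergence of the curves *)

Section CycleConvergence.
Variables (R : realType) (alpha : R) (g : nat -> seq bool).
Hypothesis gS : forall n, g n.+2 = g n.+1 ++ g n.
Hypothesis g_neq0 : forall n, g n != [::].
Hypothesis cos_ge0 : 0 <= cos alpha.

Lemma odd_turn_period :
  (forall n, (n < 2)%N -> odd (size (g (n + 6)%N)) = odd (size (g n)) /\
    turn alpha (g (n + 6)%N) 1 = turn alpha (g n) 1) ->
  forall n, odd (size (g (n + 6)%N)) = odd (size (g n)) /\
    turn alpha (g (n + 6)%N) 1 = turn alpha (g n) 1.
Proof.
pose P n := odd (size (g (n + 6)%N)) = odd (size (g n)) /\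
  turn alpha (g (n + 6)%N) 1 = turn alpha (g n) 1.
move=> P01 n; suff [] : P n /\ P n.+1 by [].
elim: n => [|n [[o0 t0] [o1 t1]]]; first by split; exact: P01.
split=> //; rewrite /P !addSn !gS !size_cat !oddD -!addSn o0 o1; split=> //.
rewrite !turn_cat t1 (turn_eq t0); congr (_ + _).
by apply: odd_turn; rewrite !oddD o1.
Qed.

(** Errors of the two factors add, so a cycle collects [C, C, 2C, 3C, 5C, 8C]; each new cycle starts
    afresh with [C, C]. *)
Lemma disp_period (L C : R) :
  (forall n, odd (size (g (n + 6)%N)) = odd (size (g n)) /\
    turn alpha (g (n + 6)%N) 1 = turn alpha (g n) 1) ->
  (forall k n, (n < 2)%N -> forall j th,
     `|disp alpha (g (6 * k + n + 6)%N) j th -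
       L *: disp alpha (g (6 * k + n)%N) j th| <= C) ->
  forall n j th,
    `|disp alpha (g (n + 6)%N) j th - L *: disp alpha (g n) j th| <= 8 * C.
Proof.
move=> per bd01.
pose bd a n := forall j th,
  `|disp alpha (g (n + 6)%N) j th - L *: disp alpha (g n) j th| <= a.
have C0 : 0 <= C by exact: le_trans (bd01 0%N 0%N isT 0%N 0).
have bdS a b n : bd a n.+1 -> bd b n -> bd (a + b) n.+2.
  move=> ba bb j th; have [o1 t1] := per n.+1.
  rewrite gS [(n.+2 + 6)%N]addSn [(n.+1 + 6)%N]addSn gS !disp_cat.
  rewrite -[(n + 6).+1]addSn.
  rewrite (turn_eq t1) (@odd_disp _ _ (g (n + 6)%N) _ (j + size (g n.+1)))//;
    last first.
    by rewrite !oddD o1.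
  by rewrite scalerDr opprD addrACA (le_trans (ler_normD _ _))// lerD.
move=> n; suff : bd (8 * C) n by [].
rewrite (divn_eq n 6) mulnC; set k := (n %/ 6)%N.
have : (n %% 6 < 6)%N by rewrite ltn_mod.
have b0 : bd C (6 * k)%N by have := bd01 k 0%N isT; rewrite addn0.
have b1 : bd C (6 * k).+1 by have := bd01 k 1%N isT; rewrite addn1.
have b2 := bdS _ _ _ b1 b0; have b3 := bdS _ _ _ b2 b1.
have b4 := bdS _ _ _ b3 b2; have b5 := bdS _ _ _ b4 b3.
have le a m : a <= 8 * C -> bd a m -> bd (8 * C) m.
  by move=> a8 bm j th; exact: le_trans a8.
case: (n %% 6)%N => [|[|[|[|[|[|//]]]]]] _ /=; rewrite ?addnS addn0.
- by apply: le b0; lra.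
- by apply: le b1; lra.
- by apply: le b2; lra.
- by apply: le b3; lra.
- by apply: le b4; lra.
- by apply: le b5; lra.
Qed.

Let q := 1 + cos alpha.
Variables (p0 p1 : bool) (r0 r1 A B a b : R) (r : nat).
Hypothesis A_le1 : `|A| <= 1.
Hypothesis B_le1 : `|B| <= 1.

(** The pair [(A, B)] is the fixed direction of the displacement of [g n]:
    [(cos alpha, - sin alpha)] for the even cycle, [(1, 0)] for the odd one. *)
Let P n u y v := drawn alpha (g n) p0 r0 (A * y) (B * y) /\
  drawn alpha (g n.+1) p1 r1 u v.

Hypothesis PS : forall n u y v, P n u y v -> P (n + 6)%N
  ((4 * q ^+ 2 - 2 * q + 1) * u + 2 * q ^+ 2 * y)
  (4 * q * u + (2 * q + 1) * y) (v + a * u + b * y).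
Hypothesis P_edist : forall k u y v, 0 < y -> P (6 * k)%N u y v ->
  u <= Defs.edist (0, 0) (disp alpha (g (6 * k + r)%N) 1 (pi / 2)).

(* The scaling ratio [L] over six steps is the larger eigenvalue of the
   unimodular matrix of [PS], whose trace is [4 q^2 + 2]. *)
Lemma cycle_converges u0 y0 v0 : 0 < u0 -> 0 < y0 -> P 0 u0 y0 v0 ->
  hausdorff_converges (fun k =>
    dilate (Num.sqrt 2 / Defs.edist (0, 0)
              (last (0, 0) (vertices alpha (g (6 * k + r)%N))))
           (curve alpha (g (6 * k + r)%N))).
Proof.
move=> u0_gt0 y0_gt0 P0.
pose next (s : R * R * R) := (
  (4 * q ^+ 2 - 2 * q + 1) * s.1.1 + 2 * q ^+ 2 * s.1.2,
  4 * q * s.1.1 + (2 * q + 1) * s.1.2, s.2 + a * s.1.1 + b * s.1.2).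
pose st k := iter k next (u0, y0, v0).
pose u k := (st k).1.1; pose y k := (st k).1.2; pose v k := (st k).2.
have Pk k : P (6 * k)%N (u k) (y k) (v k).
  by elim: k => // k IH; rewrite mulnS addnC; exact: PS.
have q_ge1 : 1 <= q by rewrite /q lerDl.
(* The larger root of [x ^ 2 - (4 q ^ 2 + 2) x + 1], whose discriminant is
   [16 q ^ 2 (q ^ 2 + 1)]. *)
pose w := Num.sqrt (q ^+ 2 + 1); pose L := 2 * q ^+ 2 + 1 + 2 * q * w.
have w2 : w ^+ 2 = q ^+ 2 + 1 by rewrite sqr_sqrtr// addr_ge0// sqr_ge0.
have w1 : 1 <= w.
  by rewrite -[leLHS]sqrtr1 ler_wsqrtr// lerDr sqr_ge0.
have L_root : L ^+ 2 = (4 * q ^+ 2 + 2) * L - 1.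
  have -> : L ^+ 2 = (2 * q ^+ 2 + 1) ^+ 2 + 2 * (2 * q ^+ 2 + 1) * (2 * q * w)
    + 4 * q ^+ 2 * w ^+ 2 by rewrite /L; ring.
  by rewrite w2 /L; ring.
have qq : 1 <= q ^+ 2 by rewrite exprn_ege1.
have qq' : q <= q ^+ 2 by rewrite expr2 ler_peMr// (le_trans _ q_ge1).
have qw : 1 <= q * w by rewrite -[leLHS]mulr1 ler_pM.
have L_ge4 : 4 <= L by rewrite /L; move: qq qw; lra.
have L_ge : 2 * q + 1 <= L by rewrite /L; move: qq' qw; lra.
have [D res] : exists D, forall k, [/\ `|u k.+1 - L * u k| <= D,
    `|y k.+1 - L * y k| <= D & `|v k.+1 - L * v k| <= D].
  exact: (@residue_bounded _ q L a b).
have [d d0 ud] : exists2 d, 0 < d & forall k, d * L ^+ k <= u k.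
  exact: (@dynamics_growth _ q L u y).
have yk k : 0 < y k by have [] := @dynamics_gt0 _ q u y _ _ _ _ _ k.
have P06 : P 6 (u 1%N) (y 1%N) (v 1%N) := Pk 1%N.
have per : forall n, odd (size (g (n + 6)%N)) = odd (size (g n)) /\
    turn alpha (g (n + 6)%N) 1 = turn alpha (g n) 1.
  apply: odd_turn_period; move: P0 P06.
  move=> [[o0 t0 _] [o1 t1 _]] [[o6 t6 _] [o7 t7 _]].
  by case=> [|[|//]] _; rewrite ?o0 ?o1 ?o6 ?o7 ?t0 ?t1 ?t6 ?t7.
have D0 : 0 <= D by have [+ _ _] := res 0%N; exact: le_trans.
have bd01 k n : (n < 2)%N -> forall j th,
    `|disp alpha (g (6 * k + n + 6)%N) j th -
      L *: disp alpha (g (6 * k + n)%N) j th| <= 2 * D.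
  have [d0k d1k] := Pk k; have := Pk k.+1; rewrite mulnS addnC => -[d0S d1S].
  have [uD yD vD] := res k.
  have scaled (e : R) : `|e| <= 1 -> `|e * y k.+1 - L * (e * y k)| <= D.
    move=> e1; rewrite mulrCA -mulrBr normrM -[leRHS]mul1r.
    exact: ler_pM.
  case: n => [|[|//]] _ j th; rewrite ?addn0 ?addn1 ?addSn.
    by apply: (drawn_dispB d0k d0S); exact: scaled.
  exact: (drawn_dispB d1k d1S).
apply: (@self_similar_converges _ _ _ L (8 * (2 * D)) gS g_neq0 _ _ L_ge4 _ r
  d d0).
- by move=> n; case: (per n).
- by move=> n; case: (per n).
- exact: disp_period.
- by move=> k; rewrite (le_trans (ud k))// (P_edist (yk k) (Pk k)).
Qed.

End CycleConvergence.

(** * The first Fibonacci words *)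

Section InitialWords.
Variables (R : realType) (alpha : R).
Let c := cos alpha.
Let s := sin alpha.

Let cs m : m * (c * c + s * s) = m.
Proof. by rewrite -!expr2 cos2Dsin2 mulr1. Qed.

Ltac trig_ring h := rewrite ?(cosN, sinN, cosD, sinD, cos0, sin0) -/c -/s;
  have := cs h; have := cs (c * h); have := cs (s * h);
  have := cs 1; have := cs c; have := cs s; lra.

Lemma drawn0 : drawn alpha [:: false] true (- alpha) 1 0.
Proof. by split; rewrite //= ?addr0// cos0 sin0. Qed.

Lemma drawn1 : drawn alpha [:: true] true 0 1 0.
Proof. by split; rewrite //= ?addr0// cos0 sin0. Qed.

(** Consecutive zeros turn by [- alpha] and then back by [alpha], so the path is a staircase with
    directions 0 and [- alpha] alternating. *)
Lemma drawn_nseq h :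
  drawn alpha (nseq (2 * h) false) false 0 (h%:R + h%:R * c) (- h%:R * s).
Proof.
elim: h => [|h IH].
  by split=> //=; rewrite oppr0 !mul0r addr0.
rewrite mulnS -[nseq _ _]/([:: false] ++ ([:: false] ++ nseq (2 * h) false)).
apply: drawn_eq (drawn_cat_odd drawn0 (drawn_cat_odd drawn0 IH)) _ _ _;
  rewrite -?natr1; trig_ring (h%:R : R).
Qed.

Lemma drawn_fib2_odd h : drawn alpha (fib_word (2 * h).+1 2) true 0
  (h%:R + h%:R * c + 1) (- h%:R * s).
Proof.
rewrite /fib_word /= -cats1.
apply: drawn_eq (drawn_cat_even (drawn_nseq h) drawn1) _ _ _;
  trig_ring (h%:R : R).
Qed.

Lemma drawn_fib2_even h : drawn alpha (fib_word (2 * h).+2 2) false (- alpha)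
  (h.+1%:R + h.+1%:R * c) (- h.+1%:R * s).
Proof.
rewrite /fib_word /= -cats1 -cat_cons.
rewrite -[false :: _]/([:: false] ++ nseq (2 * h) false).
apply: drawn_eq
  (drawn_cat_odd (drawn_cat_odd drawn0 (drawn_nseq h)) drawn1) _ _ _;
  rewrite -?natr1; trig_ring (h%:R : R).
Qed.

Lemma fib_wordS i n : fib_word i n.+3 = fib_word i n.+2 ++ fib_word i n.+1.
Proof. by []. Qed.

(** For even [i] the cycle is entered at the fourth and fifth words: their parities, turns and the
    direction of the first displacement are those required by [even_cycle]. *)
Lemma drawn_fib45_even h (H := h.+1%:R : R) (y := 2 * H + 1 + 2 * H * c) :
  drawn alpha (fib_word (2 * h).+2 4) true (- alpha) (c * y) (- s * y) /\
  drawn alpha (fib_word (2 * h).+2 5) false alpha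
    (c * (y + H) + H + 1) (- s * (y + H)).
Proof.
have d1 : drawn alpha (fib_word (2 * h).+2 1) true (- alpha) 1 0 := drawn0.
have d2 := drawn_fib2_even h; rewrite -/H in d2.
have d3 : drawn alpha (fib_word (2 * h).+2 3) true (- alpha - alpha)
    (H + H * c + c) (- H * s - s).
  rewrite fib_wordS; apply: drawn_eq (drawn_cat_even d2 d1) _ _ _; trig_ring H.
have d4 : drawn alpha (fib_word (2 * h).+2 4) true (- alpha) (c * y) (- s * y).
  rewrite fib_wordS; apply: drawn_eq (drawn_cat_odd d3 d2) _ _ _;
  rewrite /y; trig_ring H.
split=> //.
rewrite fib_wordS; apply: drawn_eq (drawn_cat_odd d4 d3) _ _ _;
  rewrite /y; trig_ring H.
Qed.

Lemma fib_word_neq0 i n : fib_word i n != [::].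
Proof.
case: n => [//|n].
suff [] : fib_word i n.+1 != [::] /\ fib_word i n.+2 != [::] by [].
elim: n => [|n [IH1 IH2]]; first by rewrite /fib_word /=; case: i.-1.
split=> //; rewrite fib_wordS -size_eq0 size_cat addn_eq0 !size_eq0.
by rewrite negb_and IH2.
Qed.

End InitialWords.

(** * The two parities of [i] *)

Unset Implicit Arguments.
Set Strict Implicit.

Theorem theorem5p5 (R : realType) (i : nat) (alpha : R) :
  (2 <= i)%N -> 0 < alpha -> alpha <= pi / 2 ->
  (~~ odd i ->
    hausdorff_converges (fun k : nat =>
      dilate (Num.sqrt 2 / fib_width i alpha (6 * k + 5))
             (fib_curve i alpha (6 * k + 5)))) /\
  (odd i ->
    hausdorff_converges (fun k : nat =>
      dilate (Num.sqrt 2 / fib_width i alpha (6 * k + 3))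
             (fib_curve i alpha (6 * k + 3)))).
Proof.
move=> i2 a0 api.
(* The upper bound on [alpha] enters through this sign, which gives [q >= 1] and hence [L >= 4]. *)
have c0 : 0 <= cos alpha.
  apply: cos_ge0_pihalf; rewrite api (le_trans _ (ltW a0))//.
  by rewrite oppr_le0 divr_ge0// pi_ge0.
have c1 : `|cos alpha| <= 1 by rewrite ler_norml cos_geN1 cos_le1.
have s1 : `|- sin alpha| <= 1 by rewrite normrN ler_norml sin_geN1 sin_le1.
split=> [ie|io].
- have [h iE] : exists h, i = (2 * h).+2.
    exists (i./2.-1); have := odd_double_half i; rewrite (negbTE ie) add0n.
    by case: (i./2) => [i0|h <-]; [rewrite -i0 in i2|rewrite /= mul2n].
  (* With this shift [f_{6k+5}] is [g (6 * k + 1)], whence [r = 1] below. *)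
  pose g n := fib_word i n.+4.
  have gS n : g n.+2 = g n.+1 ++ g n by [].
  have [d4 d5] := drawn_fib45_even alpha h; rewrite -iE in d4 d5.
  set H := (h.+1%:R : R) in d4 d5; have H0 : 0 < H by rewrite ltr0n.
  have y0 : 0 < 2 * H + 1 + 2 * H * cos alpha.
    by rewrite ltr_pwDl ?addr_gt0 ?mulr_gt0// !mulr_ge0// ltW.
  have u0 : 0 < cos alpha * (2 * H + 1 + 2 * H * cos alpha + H) + H + 1.
    by rewrite ltr_wpDl// addr_ge0 ?(ltW H0)// mulr_ge0// addr_ge0// ltW.
  have := @cycle_converges R alpha g gS (fun n => fib_word_neq0 i n.+4) c0
    true false (- alpha) alpha (cos alpha) (- sin alpha)
    (- sin alpha * (4 * (1 + cos alpha) + 2))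
    (- sin alpha * (2 * (1 + cos alpha) + 2)) 1 c1 s1 _ _ _ _ _ u0 y0
    (conj d4 d5).
  rewrite /fib_width /fib_curve.
  under [X in _ -> _ -> hausdorff_converges X]eq_fun do rewrite /g -!addnS.
  apply.
  + move=> n u y v [e0 e1]; have [e6 e7] := even_cycle gS e0 e1.
    by split=> //; apply: drawn_eq e7 _ _ _ => //; ring.
  + by move=> k u y v _ [_ /drawn_edist]; rewrite addn1.
- have [h iE] : exists h, i = (2 * h).+1.
    by exists i./2; rewrite -[LHS]odd_double_half io mul2n.
  (* Here [f_{6k+3}] is [g (6 * k + 2)], whence [r = 2] below. *)
  pose g n := fib_word i n.+1.
  have gS n : g n.+2 = g n.+1 ++ g n by [].
  have d2 := drawn_fib2_odd alpha h; rewrite -iE in d2.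
  have d1 : drawn alpha (g 0%N) true (- alpha) (1 * 1) (0 * 1).
    by rewrite mulr1 mul0r; exact: drawn0.
  have u0 : 0 < h%:R + h%:R * cos alpha + 1.
    by rewrite ltr_wpDl// addr_ge0// mulr_ge0.
  have n1 : `|1 : R| <= 1 by rewrite normr1.
  have n0 : `|0 : R| <= 1 by rewrite normr0.
  have := @cycle_converges R alpha g gS (fun n => fib_word_neq0 i n.+1) c0
    true true (- alpha) 0 1 0
    (- sin alpha * (2 + 4 * cos alpha))
    (- sin alpha * (2 + 2 * cos alpha)) 2 n1 n0 _ _ _ _ _ u0 ltr01
    (conj d1 d2).
  rewrite /fib_width /fib_curve.
  under [X in _ -> _ -> hausdorff_converges X]eq_fun do rewrite /g -!addnS.
  apply.
  + move=> n u y v; rewrite mul1r mul0r => -[e0 e1].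
    have [e6 e7] := odd_cycle gS e0 e1.
    rewrite mul1r mul0r; split=> //.
    by apply: drawn_eq e7 _ _ _ => //; ring.
  + move=> k u y v y0 [e0 e1].
    (* The word is [g (6 * k + 1)], of turn 0, followed by [g (6 * k)], so its first coordinate is
       [u + y], at least [u]. *)
    have := drawn_edist (drawn_cat_odd e1 e0); rewrite -gS addn2.
    by apply: le_trans; rewrite cos0 sin0 !mul1r !mul0r addr0 lerDl ltW.
Qed.
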